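(* Let $E$ be a set and let some subsets of $E$ be designated as $\phi$-classes, such that $(E,\phi)$ is a geometrical system in the generalized sense of Whitehead (as defined in the context). Suppose moreover that $E$ is finite and $E$ is $\phi$-maximal. Then $E$ is a simple matroid whose closure operator is $u\mapsto \operatorname{cm}_\phi(u)$. Moreover, a subset of $E$ is a flat of this matroid if and only if it is an intersection of $\phi$-classes. The independent sets of the matroid are exactly the $\phi$-axial subsets of $E$ together with the empty set. Finally, the rank function of the matroid equals the $\phi$-dimension number on every nonempty subset of $E$.
   Context: Whitehead's terminology. Let $E$ be a set and let some subsets of $E$ be designated as $\phi$-classes. For $u\subseteq E$, the $\phi$-common region $\operatorname{cm}_\phi(u)$ is the intersection of all $\phi$-classes containing $u$ (the intersection of the empty family being $E$). Two subsets $u,v\subseteq E$ are $\phi$-equivalent if $\operatorname{cm}_\phi(u)=\operatorname{cm}_\phi(v)$. A nonempty set $u\subseteq E$ is $\phi$-prime if no proper subset of $u$ has the same $\phi$-common region as $u$. A $\phi$-prime set is $\phi$-axial if it has the largest cardinality among all $\phi$-prime sets having the same $\phi$-common region. For nonempty $u\subseteq E$, the $\phi$-dimension number $\dim_\phi(u)$ is the cardinality of a $\phi$-axial set that is $\phi$-equivalent to $u$. A nonempty set $u\subseteq E$ is $\phi$-maximal if every $\phi$-prime subset of $u$ that is $\phi$-equivalent to $u$ is $\phi$-axial. $(E,\phi)$ is a geometrical system in the generalized sense of Whitehead if: ($\lambda$) $E$ is a $\phi$-class; ($\mu$) for every $x\in E$ the singleton $\{x\}$ is a $\phi$-class; ($\nu'$)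 $\dim_\phi(E)$ is finite and $\operatorname{cm}_\phi(\emptyset)=\emptyset$; ($\pi$) for every $u\subseteq E$ and every $\phi$-axial subset $v$ of $\operatorname{cm}_\phi(u)$, there exists $w\subseteq E$ such that $v\cup w$ is $\phi$-axial and $\phi$-equivalent to $u$; ($\rho$) for all $\phi$-axial $u,v\subseteq E$ with $|u\cap v|\ge 2$, the set $u\cup v$ is $\phi$-maximal. A simple matroid is a matroid with no loops and no parallel pairs (every set of at most two elements is independent). *)

(* Defs.v *)
From mathcomp Require Import all_boot.

Set Implicit Arguments.
Unset Strict Implicit.
Unset Printing Implicit Defensive.

Section Whitehead.
Variables (E : finType) (phi : {set {set E}}).
Implicit Types u v w : {set E}.

Definition cm u : {set E} := \bigcap_(C in phi | u \subset C) C.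

Definition phi_equiv u v : bool := cm u == cm v.

Definition phi_prime u : bool :=
  (u != set0) && [forall v : {set E}, (v \proper u) ==> ~~ phi_equiv v u].

Definition phi_axial u : bool :=
  phi_prime u &&
  [forall v : {set E}, phi_prime v && phi_equiv v u ==> (#|v| <= #|u|)].

Definition phi_has_dim u : bool :=
  [exists v : {set E}, phi_axial v && phi_equiv v u].

(* Meaningful only when phi_has_dim u holds; the value is then independent of
   the chosen axial set (phi_dimE); otherwise it is the junk value 0. *)
Definition phi_dim u : nat :=
  oapp (fun v : {set E} => #|v|) 0 [pick v | phi_axial v && phi_equiv v u].

Definition phi_maximal u : bool :=
  (u != set0) &&
  [forall v : {set E},
     [&& v \subset u, phi_prime v & phi_equiv v u] ==> phi_axial v].

(* In gs_nu_dim, "the dimension number of E is finite" is read as "it exists":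
   over a finType every cardinality is finite.  Axial sets being nonempty, this
   forces E to be nonempty. *)
Record geometrical_system : Prop := GeometricalSystem {
  gs_lambda : [set: E] \in phi;
  gs_mu : forall x : E, [set x] \in phi;
  gs_nu_dim : phi_has_dim [set: E];
  gs_nu_cm0 : cm set0 = set0;
  gs_pi : forall u v, phi_axial v -> v \subset cm u ->
    exists w, phi_axial (v :|: w) /\ phi_equiv (v :|: w) u;
  gs_rho : forall u v, phi_axial u -> phi_axial v -> 2 <= #|u :&: v| ->
    phi_maximal (u :|: v)
}.

Lemma phi_dimE u v : phi_axial v -> phi_equiv v u -> phi_dim u = #|v|.
Proof.
rewrite /phi_dim => axv evu; case: pickP => [w|/(_ v)]; last by rewrite axv evu.
case/andP=> axw ewu /=; apply/eqP.
case/andP: axv axw => pv /forallP/(_ w) maxv /andP[pw /forallP/(_ v) maxw].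
have ewv : phi_equiv w v by rewrite /phi_equiv (eqP ewu) (eqP evu).
have evw : phi_equiv v w by rewrite /phi_equiv eq_sym.
by rewrite eqn_leq (implyP maxv) ?pw // (implyP maxw) ?pv.
Qed.

End Whitehead.

Record matroid (E : finType) := Matroid {
  indep : pred {set E};
  indep0 : indep set0;
  indepS : forall I J : {set E}, I \subset J -> indep J -> indep I;
  indep_aug : forall I J : {set E}, indep I -> indep J -> #|I| < #|J| ->
    exists2 x, x \in J :\: I & indep (x |: I)
}.

Section Matroid.
Variables (E : finType) (M : matroid E).
Implicit Types u F : {set E}.

Definition matroid_rank u : nat :=
  \max_(I : {set E} | indep M I && (I \subset u)) #|I|.

Definition matroid_closure u : {set E} :=
  [set x | matroid_rank (x |: u) == matroid_rank u].

Definition matroid_flat F : bool := matroid_closure F == F.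

Definition simple_matroid : Prop := forall u, #|u| <= 2 -> indep M u.

End Matroid.

(* Main.v *)
(** Nonempty sets in which no element can be dropped without shrinking the
    common region are the prime sets; prime sets are thus closed under passing
    to nonempty subsets, and every nonempty [u] contains a prime set equivalent
    to it.  The maximality of [E] makes every prime set [p] axial: an axial set
    [b] equivalent to [p] extends, by (pi), to an axial set [b + w] spanning
    [E]; since [p + w] also spans [E], it contains a prime set spanning [E],
    which has [#|b| + #|w|] elements by maximality, so [#|b| <= #|p|].  By (pi)
    again, any prime subset of [cm u] now extends to a prime set equivalent to
    [u], and all the latter have the same cardinality; augmentation follows. *)
Require Import Defs.
From mathcomp Require Import all_boot.

Set Implicit Arguments.
Unset Strict Implicit.
Unset Printing Implicit Defensive.

Section CommonRegion.
Variables (E : finType) (phi : {set {set E}}).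
Implicit Types (u v w b p C : {set E}) (x : E).
Local Notation cm := (cm phi).
Local Notation prime := (phi_prime phi).
Local Notation axial := (phi_axial phi).

(** * The common region as a closure operator *)

Lemma sub_cm u : u \subset cm u.
Proof. by apply/bigcapsP => C /andP[]. Qed.

Lemma cm_sub_class u C : C \in phi -> u \subset C -> cm u \subset C.
Proof. by move=> phiC uC; apply: bigcap_inf; rewrite phiC. Qed.

Lemma cm_sub u v : u \subset cm v -> cm u \subset cm v.
Proof.
move=> uv; apply/bigcapsP => C /andP[phiC vC].
by apply: cm_sub_class => //; apply: subset_trans uv (cm_sub_class phiC vC).
Qed.

Lemma cmS u v : u \subset v -> cm u \subset cm v.
Proof. by move=> uv; apply/cm_sub/(subset_trans uv)/sub_cm. Qed.

Lemma cm_eq u v : u \subset cm v -> v \subset cm u -> cm u = cm v.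
Proof. by move=> uv vu; apply/eqP; rewrite eqEsubset !cm_sub. Qed.

Lemma cm_setU1 x u : x \in cm u -> cm (x |: u) = cm u.
Proof.
move=> xu; apply: cm_eq; first by rewrite subUset sub1set xu sub_cm.
by apply: subset_trans (sub_cm _); apply: subsetUr.
Qed.

(** Replacement principle: [u] lies in [cm v], hence in [cm (v :|: w)], and symmetrically. *)
Lemma cm_setUl u v w : cm u = cm v -> cm (u :|: w) = cm (v :|: w).
Proof.
move=> uv.
have sub a b : cm a = cm b -> a :|: w \subset cm (b :|: w).
  move=> ab; rewrite subUset (subset_trans (subsetUr b w)) ?sub_cm // andbT.
  by apply: subset_trans (sub_cm a) _; rewrite ab; apply/cmS/subsetUl.
by apply: cm_eq; apply: sub.
Qed.

Lemma cm_fixedP u :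
  cm u = u <-> exists A : {set {set E}}, A \subset phi /\ u = \bigcap_(C in A) C.
Proof.
split=> [uE | [A [Aphi ->]]].
  exists [set C in phi | u \subset C]; split; first by apply/subsetP=> C /setIdP[].
  by rewrite -[LHS]uE; apply: eq_bigl => C; rewrite inE.
apply/eqP; rewrite eqEsubset sub_cm andbT; apply/bigcapsP => C AC.
by apply: cm_sub_class; [apply: (subsetP Aphi) | apply: bigcap_inf].
Qed.

(** * Prime and axial sets *)

Lemma prime_neq0 u : prime u -> u != set0.
Proof. by case/andP. Qed.

Lemma prime_minimal u v : prime u -> v \subset u -> cm v = cm u -> v = u.
Proof.
case/andP=> _ /forallP/(_ v) /implyP minu vu euv; apply/eqP.
rewrite eqEproper vu /=; apply: contraT => /negPn/minu.
by rewrite /phi_equiv euv eqxx.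
Qed.

(** If [w], inside [v], had the same region as [v], then replacing [v] by [w] in [u] would keep the
    region of [u]; minimality of [u] then forces [w = v]. *)
Lemma sub_prime u v : v != set0 -> v \subset u -> prime u -> prime v.
Proof.
move=> v0 vu pu; rewrite /phi_prime v0; apply/forallP => w; apply/implyP.
rewrite properEneq => /andP[wv swv]; apply: contra wv => /eqP ewv.
have uE : v :|: u :\: v = u by rewrite -{1}(setIidPr vu) setID.
have wuE : w :|: u :\: v = u.
  apply: prime_minimal => //; last by rewrite (cm_setUl _ ewv) uE.
  by rewrite subUset subsetDl (subset_trans swv vu).
rewrite eqEsubset swv; apply/subsetP => x xv.
have: x \in w :|: u :\: v by rewrite wuE (subsetP vu).
by rewrite !inE xv orbF.
Qed.

Lemma axial_prime u : axial u -> prime u.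
Proof. by case/andP. Qed.

Lemma axial_max u v : axial u -> prime v -> cm v = cm u -> #|v| <= #|u|.
Proof.
case/andP=> _ /forallP/(_ v) /implyP maxu pv evu.
by apply: maxu; rewrite pv /phi_equiv evu eqxx.
Qed.

Lemma axial_eq_card u v : axial u -> axial v -> cm u = cm v -> #|u| = #|v|.
Proof.
by move=> au av e; apply/eqP; rewrite eqn_leq !axial_max // axial_prime.
Qed.

(** * Existence of prime and axial sets with a given region *)

Hypothesis cm0 : cm set0 = set0.

Lemma cm_eq0 u : cm u = set0 -> u = set0.
Proof. by move=> u0; apply/eqP; rewrite -subset0 -u0 sub_cm. Qed.

(** An inclusion-minimal set among those with the region of [u] is prime; [cm0] keeps it
    nonempty. *)
Lemma prime_subset u :
  u != set0 -> exists2 b : {set E}, b \subset u & prime b /\ cm b = cm u.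
Proof.
move=> u0; have : cm u == cm u by [].
case/(@minset_exists _ (fun v : {set E} => cm v == cm u)) =>
  b /minsetP[/eqP eb minb] bu.
exists b => //; split=> //; apply/andP; split.
  by apply: contraNneq u0 => b0; apply/eqP/cm_eq0; rewrite -eb b0 cm0.
apply/forallP => v; apply/implyP => vb.
apply/negP => /eqP ev.
have vE : v = b by apply: minb; rewrite ?ev ?eb ?proper_sub.
by rewrite vE properxx in vb.
Qed.

Hypothesis cm1 : forall x, cm [set x] = [set x].

Lemma prime1 x : prime [set x].
Proof.
have /prime_subset[b bx [pb _]] : [set x] != set0 by rewrite -cards_eq0 cards1.
by move: bx pb; rewrite subset1 => /orP[/eqP->|/eqP-> /prime_neq0/eqP].
Qed.

Lemma axial1 x : axial [set x].
Proof.
rewrite /phi_axial prime1; apply/forallP => v; apply/implyP => /andP[_ /eqP].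
by rewrite cm1 => <-; apply/subset_leq_card/sub_cm.
Qed.

(** Points are closed, so an equivalent prime subset reduced to a point already contains [u]; one
    with two elements fills [u]. *)
Lemma prime_le2 u : u != set0 -> #|u| <= 2 -> prime u.
Proof.
move=> u0 u2; have [b bu [pb eb]] := prime_subset u0.
have b0 : 0 < #|b| by rewrite card_gt0 prime_neq0.
suff <- : b = u by [].
have [/eqP/cards1P[x bE] | b1] := eqVneq #|b| 1.
  apply/eqP; rewrite eqEsubset bu /=.
  by apply: subset_trans (sub_cm u) _; rewrite -eb bE cm1.
by apply/eqP; rewrite eqEcard bu (leq_trans u2) // ltn_neqAle eq_sym b1.
Qed.

Hypothesis extend : forall u v, axial v -> v \subset cm u ->
  exists w, axial (v :|: w) /\ phi_equiv phi (v :|: w) u.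

Lemma axial_extend u v : axial v -> v \subset cm u ->
  exists2 b : {set E}, v \subset b & axial b /\ cm b = cm u.
Proof.
move=> av vu; have [w [aw /eqP ew]] := extend av vu.
by exists (v :|: w); first apply: subsetUl.
Qed.

(** A point of [u] is axial and extends by (pi). *)
Lemma axial_exists u : u != set0 -> exists2 b, axial b & cm b = cm u.
Proof.
case/set0Pn=> x xu.
have xcm : [set x] \subset cm u by rewrite sub1set (subsetP (sub_cm u)).
by have [b _ []] := axial_extend (axial1 x) xcm; exists b.
Qed.

(** * Prime sets when the whole space is maximal *)

Hypothesis maxE : phi_maximal phi [set: E].

Lemma prime_axial p : prime p -> axial p.
Proof.
move=> pp; have [b ab eb] := axial_exists (prime_neq0 pp).
have cmT : cm setT = setT by apply/eqP; rewrite -subTset sub_cm.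
have bT : b \subset cm setT by rewrite cmT subsetT.
have [d bd [ad ed]] := axial_extend ab bT.
(* [d] is [b] together with [d :\: b], and [p] may replace the equivalent [b]. *)
have spanE : cm (p :|: d :\: b) = cm setT.
  by rewrite -(cm_setUl _ eb) -ed -{1}(setIidPr bd) setID.
have pd0 : p :|: d :\: b != set0.
  by apply: contraNneq (prime_neq0 pp) => pd0; rewrite -subset0 -pd0 subsetUl.
have [c cpd [pc ec]] := prime_subset pd0.
have ac : axial c.
  case/andP: maxE => _ /forallP/(_ c) /implyP; apply.
  by rewrite subsetT pc /phi_equiv ec spanE /=.
have cd : #|c| = #|d| by apply: axial_eq_card; rewrite // ec spanE ed.
have bp : #|b| <= #|p|.
  rewrite -(leq_add2r #|d :\: b|) -{1}(setIidPr bd) cardsID -cd.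
  by apply: leq_trans (subset_leq_card cpd) _; rewrite cardsU leq_subr.
rewrite /phi_axial pp; apply/forallP => v; apply/implyP => /andP[pv /eqP ev].
by apply: leq_trans bp; apply: axial_max; rewrite // ev eb.
Qed.

Lemma prime_eq_card u v : prime u -> prime v -> cm u = cm v -> #|u| = #|v|.
Proof. by move=> pu pv; apply: axial_eq_card; apply: prime_axial. Qed.

Lemma prime_extend u v : prime v -> v \subset cm u ->
  exists2 b : {set E}, v \subset b & prime b /\ cm b = cm u.
Proof.
move=> pv vu; have [b vb [ab eb]] := axial_extend (prime_axial pv) vu.
by exists b; rewrite ?axial_prime.
Qed.

Lemma prime_leq_card u v : prime u -> prime v -> u \subset cm v -> #|u| <= #|v|.
Proof.
move=> pu pv uv; have [b ub [pb eb]] := prime_extend pu uv.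
by rewrite -(prime_eq_card pb pv eb) subset_leq_card.
Qed.

(** An extension of [u] to a prime set with the region of [v] has [#|v|] elements, so it adds
    nothing to [u]. *)
Lemma prime_eq_card_cm u v :
  prime u -> prime v -> u \subset cm v -> #|u| = #|v| -> cm u = cm v.
Proof.
move=> pu pv uv cuv; have [b ub [pb eb]] := prime_extend pu uv.
suff -> : u = b by [].
by apply/eqP; rewrite eqEcard ub (prime_eq_card pb pv eb) cuv leqnn.
Qed.

(** A prime [b] inside [x |: p] with the same region has more than [#|p|] elements, hence is all of
    [x |: p]: equal size would give [cm b = cm p], which misses [x]. *)
Lemma prime_setU1 p x : prime p -> x \notin cm p -> prime (x |: p).
Proof.
move=> pp xp; have xp0 : x |: p != set0 by apply/set0Pn; exists x; apply: setU11.
have [b bxp [pb eb]] := prime_subset xp0.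
have pcb : p \subset cm b by rewrite eb; apply/(subset_trans _ (sub_cm _))/subsetUr.
suff pltb : #|p| < #|b|.
  suff <- : b = x |: p by [].
  apply/eqP; rewrite eqEcard bxp cardsU1.
  by apply: leq_trans pltb; rewrite -add1n leq_add2r leq_b1.
rewrite ltn_neqAle prime_leq_card // andbT; apply: contraNneq xp => cpb.
by rewrite (prime_eq_card_cm pp pb pcb cpb) eb (subsetP (sub_cm _)) ?setU11.
Qed.

(** * The matroid of prime sets, with the empty set adjoined since primality excludes it *)

Definition cm_indep : pred {set E} := fun u => (u == set0) || prime u.

Lemma cm_indep0 : cm_indep set0.
Proof. by rewrite /cm_indep eqxx. Qed.

Lemma cm_indepS u v : u \subset v -> cm_indep v -> cm_indep u.
Proof.
rewrite /cm_indep => uv; case: (eqVneq u set0) => //= u0.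
case/orP=> [/eqP v0 | pv]; last exact: sub_prime pv.
by case/negP: u0; rewrite -subset0 -v0.
Qed.

Lemma cm_indep_aug u v : cm_indep u -> cm_indep v -> #|u| < #|v| ->
  exists2 x, x \in v :\: u & cm_indep (x |: u).
Proof.
move=> iu iv ltuv.
have pv : prime v.
  by case/orP: iv => // /eqP v0; rewrite v0 cards0 ltn0 in ltuv.
(* Otherwise [v] would have at most as many elements as [u]; any such [x] can be added. *)
have /subsetPn[x xv xu] : ~~ (v \subset cm u).
  case/orP: iu => [/eqP u0 | pu].
    by rewrite u0 cm0 subset0 prime_neq0.
  by apply: contraL ltuv => vu; rewrite -leqNgt prime_leq_card.
exists x; first by rewrite inE xv andbT; apply: contra xu; apply/subsetP/sub_cm.
apply/orP; right; case/orP: iu => [/eqP-> | pu]; last exact: prime_setU1.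
by rewrite setU0 prime1.
Qed.

Definition cm_matroid : matroid E := Matroid cm_indep0 cm_indepS cm_indep_aug.
Local Notation rank := (matroid_rank cm_matroid).

Lemma cm_matroid_simple : simple_matroid cm_matroid.
Proof.
move=> u u2 /=; rewrite /cm_indep; case: eqVneq => //= u0.
exact: prime_le2.
Qed.

Lemma cm_matroid_indepP u : indep cm_matroid u <-> axial u \/ u = set0.
Proof.
rewrite /= /cm_indep; split=> [/orP[/eqP | /prime_axial] | [/axial_prime pu | ->]].
- by right.
- by left.
- by rewrite pu orbT.
- by rewrite eqxx.
Qed.

(** Here [b] need not lie in [u]: independent subsets of [u] lie in [cm b], which bounds their size,
    and a prime subset of [u] equivalent to [b] attains the bound. *)
Lemma rank_prime b u : prime b -> cm b = cm u -> rank u = #|b|.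
Proof.
move=> pb eb; apply/eqP; rewrite eqn_leq; apply/andP; split.
  apply/bigmax_leqP => v /andP[/orP[/eqP-> | pv] vu]; first by rewrite cards0.
  by rewrite prime_leq_card // eb (subset_trans vu) ?sub_cm.
have u0 : u != set0.
  apply: contraNneq (prime_neq0 pb) => u0.
  by apply/eqP/cm_eq0; rewrite eb u0 cm0.
have [c cu [pc ec]] := prime_subset u0.
rewrite -(prime_eq_card pc pb) ?ec ?eb //.
by apply: (leq_bigmax_cond (F := fun v => #|v|)); rewrite /= /cm_indep pc orbT.
Qed.

Lemma rank_phi_dim u : u != set0 -> rank u = phi_dim phi u.
Proof.
move=> u0; have [b _ [pb eb]] := prime_subset u0.
rewrite (rank_prime pb eb); apply/esym/phi_dimE; first exact: prime_axial.
exact/eqP.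
Qed.

(** The ranks of [u] and [x |: u] are the sizes of equivalent prime sets [b] and [d]; as [b] lies in
    [cm d], equal sizes mean equal regions. *)
Lemma cm_matroid_closure u : matroid_closure cm_matroid u = cm u.
Proof.
apply/setP=> x; rewrite inE.
have xu0 : x |: u != set0 by apply/set0Pn; exists x; apply: setU11.
have [d _ [pd ed]] := prime_subset xu0; rewrite (rank_prime pd ed).
(* No prime set is equivalent to the empty set, whose rank 0 is computed directly. *)
have [-> | u0] := eqVneq u set0.
  have -> : rank set0 = 0.
    apply/eqP; rewrite -leqn0; apply/bigmax_leqP => v /andP[_].
    by rewrite subset0 => /eqP->; rewrite cards0.
  by rewrite cm0 inE cards_eq0 (negPf (prime_neq0 pd)).
have [b bu [pb eb]] := prime_subset u0; rewrite (rank_prime pb eb).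
apply/eqP/idP => [cdb | xu].
  2: by apply: prime_eq_card; rewrite // ed eb cm_setU1.
have bd : b \subset cm d.
  by rewrite ed (subset_trans bu) // (subset_trans _ (sub_cm _)) ?subsetUr.
rewrite -eb (prime_eq_card_cm pb pd bd (esym cdb)) ed.
by rewrite (subsetP (sub_cm _)) ?setU11.
Qed.

End CommonRegion.

Theorem theorem1 (E : finType) (phi : {set {set E}})
    (geom : geometrical_system phi)
    (Emax : phi_maximal phi [set: E]) :
  exists M : matroid E,
    [/\ simple_matroid M,
        forall u : {set E}, matroid_closure M u = cm phi u,
        forall F : {set E}, matroid_flat M F <->
          exists A : {set {set E}}, A \subset phi /\ F = \bigcap_(C in A) C,
        forall u : {set E}, indep M u <-> phi_axial phi u \/ u = set0
      & forall u : {set E}, u != set0 -> matroid_rank M u = phi_dim phi u].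
Proof.
case: geom => _ phi1 _ cm0 extend _.
have cm1 x : cm phi [set x] = [set x].
  by apply/eqP; rewrite eqEsubset sub_cm cm_sub_class.
exists (cm_matroid cm0 cm1 extend Emax); split.
- exact: cm_matroid_simple.
- exact: cm_matroid_closure.
(* Flats are now the fixed points of [cm]. *)
- move=> F; rewrite /matroid_flat cm_matroid_closure.
  by split=> [/eqP/cm_fixedP | /cm_fixedP/eqP].
- exact: cm_matroid_indepP.
- exact: rank_phi_dim.
Qed.
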